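(* Let $k\in\mathbb{N}$, $r\in[k]$, $n\in\mathbb{N}$, $\lambda>0$, and consider the spiked model in dimension $k$ with $\sigma=1$. There is a constant $c>0$ (absolute) such that \[ \inf_{\widehat{\mathbf{V}}}\sup_{\boldsymbol{\Sigma}\in\Theta_0(k,k,r,\lambda)}\mathsf{E}\bigl\|\widehat{\mathbf{V}}\widehat{\mathbf{V}}'-\mathbf{V}\mathbf{V}'\bigr\|_{\mathrm F}^2\ \ge\ c\Bigl(r\wedge(k-r)\wedge\frac{r(k-r)}{nh(\lambda)}\Bigr). \]
   Context: Spiked model in dimension $k$: the $n\times k$ data matrix has i.i.d. rows $N(0,\boldsymbol{\Sigma})$ with $\boldsymbol{\Sigma}=\mathbf{V}\boldsymbol{\Lambda}\mathbf{V}'+\mathbf{I}_k$, $\mathbf{V}\in O(k,r)=\{\mathbf{V}\in\mathbb{R}^{k\times r}:\mathbf{V}'\mathbf{V}=\mathbf{I}_r\}$, $\boldsymbol{\Lambda}=\operatorname{diag}(\lambda_1,\dots,\lambda_r)$. Fix $\kappa>1$; $\Theta_0(k,k,r,\lambda)=\{\mathbf{V}\boldsymbol{\Lambda}\mathbf{V}'+\mathbf{I}_k: 0<\lambda\le\lambda_r\le\dots\le\lambda_1\le\kappa\lambda,\ \mathbf{V}\in O(k,r)\}$. $h(\lambda)=\lambda^2/(\lambda+1)$. The infimum is over all estimators with values in $O(k,r)$. *)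

(* Defs.v *)
From HB Require Import structures.
From mathcomp Require Import all_boot all_order all_algebra.
From mathcomp Require Import all_classical all_reals all_analysis.
Set Implicit Arguments. Unset Strict Implicit. Unset Printing Implicit Defensive.
Import Order.TTheory GRing.Theory Num.Theory.
Import numFieldNormedType.Exports.
Local Open Scope classical_set_scope.
Local Open Scope ring_scope.

Fixpoint leb_int {R : realType} (m : nat) : (m.-tuple R -> \bar R) -> \bar R :=
  match m return (m.-tuple R -> \bar R) -> \bar R with
  | 0 => fun f => f [tuple]
  | m'.+1 => fun f =>
      (\int[@lebesgue_measure R]_x leb_int (fun v : m'.-tuple R => f (cons_tuple x v)))%E
  end.

Definition tup2mx {R : realType} (n k : nat) (t : (n * k).-tuple R) : 'M[R]_(n, k) :=
  \matrix_(i < n, j < k) tnth t (mxvec_index i j).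

Definition gauss_density {R : realType} (k : nat) (Sigma : 'M[R]_k) (x : 'rV[R]_k) : R :=
  (Num.sqrt ((pi *+ 2) ^+ k * \det Sigma))^-1 *
  expR (- ((x *m invmx Sigma *m x^T) 0 0) / 2).

Definition data_density {R : realType} (n k : nat) (Sigma : 'M[R]_k) (X : 'M[R]_(n, k)) : R :=
  \prod_(i < n) gauss_density Sigma (row i X).

Definition gauss_data_exp {R : realType} (n k : nat) (Sigma : 'M[R]_k)
    (g : 'M[R]_(n, k) -> \bar R) : \bar R :=
  leb_int (fun t : (n * k).-tuple R =>
    ((data_density Sigma (tup2mx t))%:E * g (tup2mx t))%E).

Definition frob2 {R : realType} (m p : nat) (A : 'M[R]_(m, p)) : R :=
  \sum_(i < m) \sum_(j < p) (A i j) ^+ 2.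

Definition orthonormal_frame {R : realType} (k r : nat) (V : 'M[R]_(k, r)) : Prop :=
  V^T *m V = 1%:M.

Definition estimator {R : realType} (n k r : nat) (Vh : 'M[R]_(n, k) -> 'M[R]_(k, r)) : Prop :=
  (forall X, orthonormal_frame (Vh X)) /\
  (forall (a : 'I_k) (b : 'I_r),
      measurable_fun [set: (n * k).-tuple R] (fun t => Vh (tup2mx t) a b)).

Definition spiked_cov {R : realType} (k r : nat) (V : 'M[R]_(k, r)) (lam : 'I_r -> R) : 'M[R]_k :=
  V *m diag_mx (\row_i lam i) *m V^T + 1%:M.

Definition Theta0_param {R : realType} (k r : nat) (kappa lambda : R)
    (V : 'M[R]_(k, r)) (lam : 'I_r -> R) : Prop :=
  orthonormal_frame V /\
  (forall i : 'I_r, lambda <= lam i <= kappa * lambda) /\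
  (forall i j : 'I_r, (i <= j)%N -> lam j <= lam i).

Definition hfun {R : realType} (lambda : R) : R := lambda ^+ 2 / (lambda + 1).

Definition max_risk {R : realType} (n k r : nat) (kappa lambda : R)
    (Vh : 'M[R]_(n, k) -> 'M[R]_(k, r)) : \bar R :=
  ereal_sup [set x | exists (V : 'M[R]_(k, r)) (lam : 'I_r -> R),
      Theta0_param kappa lambda V lam /\
      x = gauss_data_exp (spiked_cov V lam)
            (fun X => (frob2 (Vh X *m (Vh X)^T - V *m V^T))%:E)].

(* Main.v *)
(** Assouad's lemma over a hypercube of subspaces.  Write k = r + m and let W run
    over the m x r matrices with entries +d or -d, where
    d^2 = min (1 / max (r, m), 1 / (n h(lambda))) / 5; all spikes are equal to
    lambda, and V is an orthonormal frame of the graph {(x, W x)}.  The projector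
    V V' has lower-left block M(W) = W (1 + W'W)^-1 = (1 + WW')^-1 W, which
    satisfies the exact secant identity
      M(W2) - M(W1) = (1 + W1W1')^-1 (W2 - W1) (1 + W2'W2)^-1
                      - M(W1) (W2 - W1)' M(W2).
    When W2 and W1 differ in the entry (i,j) only, the (i,j) entry of the right
    side involves only diagonal entries of the inverses and M_ij(W1), M_ij(W2);
    these are controlled by the row and column norms of W, so flipping a sign
    moves M_ij by at least d although the operator norm of W may be large.

    With G the mean of the two precision matrices, the Hadamard and AM-GM
    inequalities give det (Sigma1 G) <= exp (tr (Sigma1 G) - k), and
    tr (Sigma1 G) - k = h(lambda) / 2 * (r - tr (P1 P2)) <= 2 h(lambda) d^2 for
    neighbours.  Hence the Bhattacharyya affinity of n samples under neighbouring
    parameters is at least exp (- n h(lambda) d^2) >= exp (-1/5). *)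

Require Import Defs.
From HB Require Import structures.
From mathcomp Require Import all_boot all_order all_algebra.
From mathcomp Require Import all_classical all_reals all_analysis.
From mathcomp Require Import measurable_realfun normal_distribution.
From mathcomp Require Import ring lra.
Import Order.TTheory GRing.Theory Num.Theory Num.Def.
Local Open Scope classical_set_scope.
Local Open Scope ring_scope.
Set Implicit Arguments.
Unset Strict Implicit.

Definition qf (R : realType) (N : nat) (Q : 'M[R]_N) (x : 'rV[R]_N) : R :=
  (x *m Q *m x^T) 0 0.

Definition posdef (R : realType) (N : nat) (Q : 'M[R]_N) : Prop :=
  Q^T = Q /\ forall x : 'rV[R]_N, x != 0 -> 0 < qf Q x.

(** Upper factors suit row vectors: the first coordinate of [x *m L] depends only on the first
    coordinate of [x], so Gaussian integrals can be peeled one variable at a time. *)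
Definition upper_pos (R : realType) (N : nat) (L : 'M[R]_N) : Prop :=
  (forall i j : 'I_N, (j < i)%N -> L i j = 0) /\ (forall i, 0 < L i i).

(** * Positive definite matrices *)

Section LinearAlgebra.
Context {R : realType}.
Implicit Types N k : nat.

Lemma mulmx_tr_diag m p (A : 'M[R]_(m, p)) i :
  (A *m A^T) i i = \sum_j A i j ^+ 2.
Proof. by rewrite mxE; apply: eq_bigr => j _; rewrite mxE expr2. Qed.

Lemma mxBE m p (A B : 'M[R]_(m, p)) i j : (A - B) i j = A i j - B i j.
Proof. by rewrite !mxE. Qed.

Lemma mxZE m p (a : R) (A : 'M[R]_(m, p)) i j : (a *: A) i j = a * A i j.
Proof. by rewrite !mxE. Qed.

Lemma row_normsq_eq0 N (x : 'rV[R]_N) : ((x *m x^T) 0 0 == 0) = (x == 0).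
Proof.
rewrite mulmx_tr_diag psumr_eq0; last by move=> i _; exact: sqr_ge0.
apply/allP/eqP => [h|-> i _]; last by rewrite mxE expr0n eqxx.
apply/rowP => i; rewrite mxE; apply/eqP.
by have := h i; rewrite mem_index_enum sqrf_eq0 => /(_ isT).
Qed.

Lemma row_normsq_ge0 m p (A : 'M[R]_(m, p)) i : 0 <= (A *m A^T) i i.
Proof. by rewrite mulmx_tr_diag; apply: sumr_ge0 => j _; exact: sqr_ge0. Qed.

Lemma row_normsq_gt0 N (x : 'rV[R]_N) : x != 0 -> 0 < (x *m x^T) 0 0.
Proof. by move=> x0; rewrite lt0r row_normsq_eq0 x0 row_normsq_ge0. Qed.

Lemma det_upper N (L : 'M[R]_N) :
  (forall i j : 'I_N, (j < i)%N -> L i j = 0) -> \det L = \prod_i L i i.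
Proof.
move=> u; rewrite -det_tr det_trig.
  by apply: eq_bigr => i _; rewrite mxE.
by apply/is_trig_mxP => i j ij; rewrite mxE u.
Qed.

Lemma upper_pos_unit N (L : 'M[R]_N) : upper_pos L -> L \in unitmx.
Proof.
case=> u p; rewrite unitmxE det_upper// unitfE; apply/lt0r_neq0.
exact: prodr_gt0.
Qed.

Lemma posdef_unit N (Q : 'M[R]_N) : posdef Q -> Q \in unitmx.
Proof.
move=> [_ p]; rewrite -row_free_unit -kermx_eq0; apply/eqP/row_matrixP => i.
rewrite row0; apply/eqP; apply: contraT => h; have := p _ h.
by rewrite /qf -row_mul mulmx_ker row0 mul0mx mxE ltxx.
Qed.

Lemma qf_congr N p (Q : 'M[R]_N) (T : 'M[R]_(p, N)) (x : 'rV[R]_p) :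
  qf (T *m Q *m T^T) x = qf Q (x *m T).
Proof. by rewrite /qf trmx_mul !mulmxA. Qed.

Lemma posdef_congr N p (Q : 'M[R]_N) (T : 'M[R]_(p, N)) :
  row_free T -> posdef Q -> posdef (T *m Q *m T^T).
Proof.
move=> fT [sQ p0]; split; first by rewrite !trmx_mul trmxK sQ mulmxA.
move=> x x0; rewrite qf_congr; apply: p0; apply: contra x0 => /eqP h.
by apply/eqP; apply: (row_free_inj fT); rewrite h mul0mx.
Qed.

Lemma posdef_inv N (Q : 'M[R]_N) : posdef Q -> posdef (invmx Q).
Proof.
move=> pQ; have uQ := posdef_unit pQ; case: (pQ) => sQ _.
have -> : invmx Q = invmx Q *m Q *m (invmx Q)^T.
  by rewrite mulVmx// mul1mx trmx_inv sQ.
by apply: posdef_congr pQ; rewrite row_free_unit unitmx_inv.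
Qed.

Lemma posdefD N (A B : 'M[R]_N) : posdef A -> posdef B -> posdef (A + B).
Proof.
move=> [sA pA] [sB pB]; split; first by rewrite linearD /= sA sB.
move=> x x0; rewrite /qf mulmxDr mulmxDl mxE; apply: addr_gt0.
  exact: pA.
exact: pB.
Qed.

Lemma posdefZ N (a : R) (A : 'M[R]_N) : 0 < a -> posdef A -> posdef (a *: A).
Proof.
move=> a0 [sA pA]; split; first by rewrite linearZ /= sA.
by move=> x x0; rewrite /qf -scalemxAr -scalemxAl mxE mulr_gt0// pA.
Qed.

Lemma qf_delta N (Q : 'M[R]_N) i : qf Q (delta_mx 0 i) = Q i i.
Proof. by rewrite /qf -rowE trmx_delta -colE !mxE. Qed.

Lemma posdef_diag_gt0 N (Q : 'M[R]_N) i : posdef Q -> 0 < Q i i.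
Proof.
case=> _ p; rewrite -qf_delta; apply: p; apply/eqP => /matrixP /(_ 0 i).
by rewrite !mxE !eqxx; apply/eqP/oner_neq0.
Qed.

Lemma mx11_trE (A : 'M[R]_1) : A^T = A.
Proof. by rewrite (mx11_scalar A) tr_scalar_mx. Qed.

(** Induction on the lower-right block: for Q = [a, q; q', Q2] with Q2 = L2 L2', the off-diagonal
    row of the factor is w = q (L2')^-1 and its corner is the square root of the Schur complement s
    = a - w w'. *)
Lemma cholesky N (Q : 'M[R]_N) : posdef Q ->
  exists2 L, upper_pos L & Q = L *m L^T.
Proof.
elim: N Q => [|N IH] Q pQ.
  by exists 0; [split=> [] [] | apply/matrixP => [] []].
case: (pQ) => sQ p.
move: p sQ; rewrite -[Q](@submxK R 1 N 1 N).
set a := ulsubmx _; set q := ursubmx _; set q' := dlsubmx _; set Q2 := drsubmx _.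
rewrite (@tr_block_mx R 1 N 1 N) => p /(@eq_block_mx _ 1 N 1 N) [_ _ qE sQ2].
have qqE (u : 'M[R]_1) (x : 'rV[R]_N) :
   row_mx u x *m block_mx a q q' Q2 *m (row_mx u x)^T
   = u *m a *m u + x *m q^T *m u + (u *m q *m x^T + x *m Q2 *m x^T).
  rewrite (@mul_row_block R 1 1 N) tr_row_mx (@mul_row_col R 1 1 N) qE mx11_trE.
  by rewrite !mulmxDl.
have pQ2 : posdef Q2.
  split=> // x x0; have := p (row_mx (0 : 'M[R]_1) x); rewrite /qf qqE.
  rewrite !mul0mx mulmx0 !add0r; apply; apply: contra x0 => /eqP.
  by rewrite -(@row_mx0 R 1 1 N) => /(@eq_row_mx _ 1 1 N) [_ ->].
have [L2 uL2 Q2E] := IH _ pQ2.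
have iL2 := upper_pos_unit uL2.
have iL2T : L2^T \in unitmx by rewrite unitmx_tr.
pose w := q *m invmx L2^T.
pose s := a 0 0 - (w *m w^T) 0 0.
have s0 : 0 < s.
  (* s is the value of the form at (1, -z) with z = q Q2^-1, the minimiser over the second
     component. *)
  pose z := w *m invmx L2.
  have := p (row_mx (1%:M : 'M[R]_1) (- z)); rewrite /qf qqE.
  have zQ2 : z *m Q2 = q by rewrite Q2E /z mulmxA mulmxKV// /w mulmxKV.
  have wz : w *m w^T = z *m q^T.
    by rewrite /z /w trmx_mul trmx_inv trmxK mulmxA.
  rewrite !mul1mx !mulmx1 !mulNmx zQ2 addrN addr0 -wz => h.
  have -> : s = (a - w *m w^T) 0 0 by rewrite mxBE.
  apply: h.
  rewrite -(@row_mx0 R 1 1 N).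
  apply/eqP => /(@eq_row_mx _ 1 1 N) [/matrixP /(_ 0 0)]; rewrite !mxE.
  by rewrite eqxx => /eqP; rewrite oner_eq0.
exists (block_mx (Num.sqrt s)%:M w 0 L2 : 'M[R]_(1 + N)).
  case: uL2 => u2 p2; split=> [i j|i].
    case: (@split_ordP 1 N i) => i' ->; case: (@split_ordP 1 N j) => j' ->.
    - by rewrite !ord1.
    - by rewrite ord1.
    - by rewrite (@block_mxEdl R 1 N 1 N) mxE.
    - by rewrite (@block_mxEdr R 1 N 1 N) /= ltn_add2l; exact: u2.
  case: (@split_ordP 1 N i) => i' ->.
    by rewrite (@block_mxEul R 1 N 1 N) !ord1 mxE eqxx mulr1n sqrtr_gt0.
  by rewrite (@block_mxEdr R 1 N 1 N).
rewrite (@tr_block_mx R 1 N 1 N) (@mulmx_block R 1 N 1 N 1 N) trmx0 tr_scalar_mx.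
have qw : q = w *m L2^T by rewrite /w mulmxKV.
rewrite !mul0mx !mulmx0 !add0r -Q2E -qw -qE.
rewrite [in X in block_mx _ _ X]qw trmx_mul trmxK.
suff <- : a = (Num.sqrt s)%:M *m (Num.sqrt s)%:M + w *m w^T by [].
rewrite [a]mx11_scalar [w *m _]mx11_scalar -scalar_mxM -raddfD /=.
by congr (_%:M); rewrite -expr2 sqr_sqrtr ?(ltW s0)// /s subrK.
Qed.

(** For A = L L' the determinant is the product of the L_ii^2. Each is at most exp (L_ii^2 - 1)
    because 1 + t <= exp t, and their sum is at most tr A. *)
Lemma posdef_det N (A : 'M[R]_N) :
  posdef A -> 0 < \det A <= expR (\tr A - N%:R).
Proof.
move=> /cholesky [L [u p] ->]; rewrite det_mulmx det_tr (det_upper u) -expr2.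
rewrite exprn_gt0 ?prodr_gt0//= /mxtrace.
rewrite -[X in _ - X%:R]card_ord -sumr_const -sumrB expR_sum -prodrXl.
apply: ler_prod => i _; rewrite sqr_ge0 /=.
apply: (@le_trans _ _ (expR (L i i ^+ 2 - 1))).
  by rewrite -[X in X <= _](subrKC 1) expR_ge1Dx.
rewrite ler_expR lerB// mulmx_tr_diag (bigD1 i)//= lerDl.
by apply: sumr_ge0 => j _; exact: sqr_ge0.
Qed.

(** A B need not be symmetric, but for A = L L' the matrix L' B L is positive definite with the
    determinant and trace of A B. *)
Lemma posdef_det_mul N (A B : 'M[R]_N) : posdef A -> posdef B ->
  \det (A *m B) <= expR (\tr (A *m B) - N%:R).
Proof.
move=> /cholesky [L uL ->] pB; have iL := upper_pos_unit uL.
rewrite -mulmxA det_mulmx mulrC -det_mulmx.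
have /andP[_] : 0 < \det (L^T *m B *m L) <= expR (\tr (L^T *m B *m L) - N%:R).
  apply: posdef_det; rewrite -[X in _ *m X]trmxK.
  by apply: posdef_congr => //; rewrite row_free_unit unitmx_tr.
by rewrite mxtrace_mulC mulmxA.
Qed.

(** With e the i-th unit row and t = 1 / S_ii, the form of S at e S^-1 - t e equals (S^-1)_ii -
    t. *)
Lemma inv_diag_ge N (S : 'M[R]_N) i : posdef S -> (S i i)^-1 <= invmx S i i.
Proof.
move=> pS; have uS := posdef_unit pS; have S0 := posdef_diag_gt0 i pS.
have [sS p] := pS; have [sA _] := posdef_inv pS.
set A := invmx S in sA *; set t := (S i i)^-1.
pose u : 'rV[R]_N := delta_mx 0 i; pose y := u *m A - t *: u.
have h : 0 <= qf S y.
  by have [->|/p/ltW//] := eqVneq y 0; rewrite /qf !mul0mx mxE.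
have e : qf S y = A i i - t.
  have yS : y *m S = u - t *: (u *m S).
    by rewrite mulmxBl -mulmxA mulVmx// mulmx1 -scalemxAl.
  have yT : y^T = A *m u^T - t *: u^T.
    by rewrite linearB /= trmx_mul sA linearZ.
  rewrite /qf yS yT mulmxBl !mulmxBr -!scalemxAl -!scalemxAr.
  rewrite -[u *m S *m (A *m _)]mulmxA (mulmxA S) mulmxV// mul1mx (mulmxA u A).
  have uu : (u *m u^T) 0 0 = 1 by rewrite /u trmx_delta mul_delta_mx mxE !eqxx.
  have uSu : (u *m S *m u^T) 0 0 = S i i by exact: qf_delta.
  have uAu : (u *m A *m u^T) 0 0 = A i i by exact: qf_delta.
  rewrite [LHS]mxE mxBE [X in _ + X]mxE mxBE !mxZE uu uSu uAu.
  by rewrite /t mulVf ?gt_eqF// mulr1 subrr subr0.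
by rewrite e subr_ge0 in h.
Qed.
End LinearAlgebra.

(** * Projectors onto graphs *)

Definition graph_inv (R : realType) (m r : nat) (W : 'M[R]_(m, r)) : 'M[R]_r :=
  invmx (1%:M + W^T *m W).

Definition graph_mx (R : realType) (m r : nat) (W : 'M[R]_(m, r)) :
    'M[R]_(r + m, r) := col_mx 1%:M W.

(* The orthogonal projector onto the graph {(x, W x)}. *)
Definition graph_proj (R : realType) (m r : nat) (W : 'M[R]_(m, r)) :
    'M[R]_(r + m) := graph_mx W *m graph_inv W *m (graph_mx W)^T.


Section GraphProjector.
Context {R : realType}.
Implicit Types m r : nat.

Lemma graph_gramE m r (W : 'M[R]_(m, r)) :
  (graph_mx W)^T *m graph_mx W = 1%:M + W^T *m W.
Proof. by rewrite /graph_mx tr_col_mx mul_row_col trmx1 mul1mx. Qed.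

Lemma posdef_1D_gram m r (W : 'M[R]_(m, r)) : posdef (1%:M + W^T *m W).
Proof.
split=> [|x x0]; first by rewrite linearD /= trmx1 trmx_mul trmxK.
rewrite /qf mulmxDr mulmx1 mulmxDl mxE ltr_wpDr ?row_normsq_gt0//.
rewrite mulmxA -mulmxA; have -> : W *m x^T = (x *m W^T)^T by rewrite trmx_mul trmxK.
exact: row_normsq_ge0.
Qed.

Lemma posdef_graph_inv m r (W : 'M[R]_(m, r)) : posdef (graph_inv W).
Proof. exact/posdef_inv/posdef_1D_gram. Qed.

Lemma graph_inv_sym m r (W : 'M[R]_(m, r)) : (graph_inv W)^T = graph_inv W.
Proof. by case: (posdef_graph_inv W). Qed.

Lemma gram_graph_inv m r (W : 'M[R]_(m, r)) :
  W^T *m W *m graph_inv W = 1%:M - graph_inv W.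
Proof.
have u := posdef_unit (posdef_1D_gram W).
apply/eqP; rewrite eq_sym subr_eq -[X in _ + X]mul1mx -mulmxDl addrC.
by rewrite mulmxV.
Qed.

Lemma gramT_graph_inv m r (W : 'M[R]_(m, r)) :
  graph_inv W^T *m (W *m W^T) = 1%:M - graph_inv W^T.
Proof.
have := gram_graph_inv W^T; rewrite trmxK => /(congr1 trmx).
by rewrite !trmx_mul trmxK linearB /= trmx1 graph_inv_sym mulmxA.
Qed.

(** Push-through identity: both sides become W after right multiplication by 1 + W'W. *)
Lemma graph_invC m r (W : 'M[R]_(m, r)) :
  W *m graph_inv W = graph_inv W^T *m W.
Proof.
have u := posdef_unit (posdef_1D_gram W).
apply: (can_inj (mulmxK u)); rewrite mulmxKV//.
rewrite mulmxDr mulmx1 -[graph_inv _ *m W *m _]mulmxA (mulmxA W) mulmxA.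
by rewrite gramT_graph_inv mulmxBl mul1mx addrC subrK.
Qed.

(** Put A1 = [graph_inv W1^T], G2 = [graph_inv W2] and M1 = A1 W1. After expansion, W2'W2 G2 = 1 -
    G2 and M1 W1' = 1 - A1 remove the longer products, and the remaining terms cancel. *)
Lemma graph_slope_secant m r (W1 W2 : 'M[R]_(m, r)) :
  W2 *m graph_inv W2 - W1 *m graph_inv W1 =
  graph_inv W1^T *m (W2 - W1) *m graph_inv W2
  - W1 *m graph_inv W1 *m (W2 - W1)^T *m (W2 *m graph_inv W2).
Proof.
rewrite [(W2 - W1)^T]linearB /= !(mulmxBr, mulmxBl).
have e1 : W1 *m graph_inv W1 *m W2^T *m (W2 *m graph_inv W2) =
    W1 *m graph_inv W1 - W1 *m graph_inv W1 *m graph_inv W2.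
  by rewrite -mulmxA (mulmxA W2^T) gram_graph_inv mulmxBr mulmx1.
have e2 : W1 *m graph_inv W1 *m W1^T *m (W2 *m graph_inv W2) =
    W2 *m graph_inv W2 - graph_inv W1^T *m W2 *m graph_inv W2.
  rewrite graph_invC -[_ *m W1 *m W1^T]mulmxA gramT_graph_inv mulmxBl mul1mx.
  by rewrite mulmxA.
rewrite e1 e2 -graph_invC.
move: (W2 *m _) (W1 *m graph_inv W1) (W1 *m _ *m graph_inv W2) (_ *m W2 *m _).
move=> a b c e.
by apply/matrixP => i j; rewrite !mxE; ring.
Qed.

(** With A = (1 + WW')^-1 the slope M = A W satisfies M M' = A - A^2. On the diagonal, M_ij^2 <= (M
    M')_ii and (A^2)_ii >= A_ii^2. *)
Lemma graph_slope_entry_sq m r (W : 'M[R]_(m, r)) i j :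
  (W *m graph_inv W) i j ^+ 2 <=
  graph_inv W^T i i - graph_inv W^T i i ^+ 2.
Proof.
set A := graph_inv W^T.
have sA : A^T = A := graph_inv_sym W^T.
have e : A *m W *m (A *m W)^T = A - A *m A^T.
  rewrite trmx_mul !sA mulmxA -(mulmxA A W) gramT_graph_inv.
  by rewrite mulmxBl mul1mx.
apply: (@le_trans _ _ ((A *m W *m (A *m W)^T) i i)).
  rewrite graph_invC mulmx_tr_diag (bigD1 j)//= lerDl.
  by apply: sumr_ge0 => l _; exact: sqr_ge0.
rewrite e mxBE lerB// mulmx_tr_diag (bigD1 i)//= lerDl.
by apply: sumr_ge0 => l _; exact: sqr_ge0.
Qed.

(** For G = [graph_inv W], G W'W G = G - G^2 has nonnegative diagonal, hence G_jj >= (G^2)_jj >=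
    G_jj^2. *)
Lemma graph_inv_diag_le1 m r (W : 'M[R]_(m, r)) j : 0 <= graph_inv W j j <= 1.
Proof.
have h := posdef_diag_gt0 j (posdef_graph_inv W); rewrite (ltW h)/=.
have e : graph_inv W *m (W^T *m W) = 1%:M - graph_inv W.
  by have := gramT_graph_inv W^T; rewrite trmxK.
have : 0 <= (graph_inv W *m W^T *m (graph_inv W *m W^T)^T) j j.
  exact: row_normsq_ge0.
rewrite trmx_mul trmxK graph_inv_sym mulmxA -(mulmxA _ W^T) e mulmxBl mul1mx mxBE.
rewrite subr_ge0 -[X in _ *m X]graph_inv_sym mulmx_tr_diag (bigD1 j)//= => h1.
have : graph_inv W j j ^+ 2 <= graph_inv W j j.
  by apply: le_trans h1; rewrite lerDl; apply: sumr_ge0 => l _; exact: sqr_ge0.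
by rewrite expr2 ger_pMr.
Qed.

Lemma graph_inv_diag_ge m r (W : 'M[R]_(m, r)) (d2 : R) j :
  (forall i, W i j ^+ 2 = d2) -> (1 + m%:R * d2)^-1 <= graph_inv W j j.
Proof.
move=> h; have := inv_diag_ge j (posdef_1D_gram W); rewrite -/(graph_inv W).
rewrite mxE mxE eqxx -[X in _ *m X]trmxK mulmx_tr_diag.
under eq_bigr do rewrite mxE h.
by rewrite sumr_const card_ord mulr_natl.
Qed.

Lemma mulmx_delta_entry m n p q (A : 'M[R]_(m, n)) (B : 'M[R]_(p, q)) i j k l :
  (A *m delta_mx j k *m B) i l = A i j * B k l.
Proof.
rewrite -(mul_delta_mx (0 : 'I_1)) mulmxA -mulmxA -rowE -colE mxE big_ord1.
by rewrite !mxE.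
Qed.

Lemma mxtrace_mul_delta m n (A : 'M[R]_(m, n)) i j :
  \tr (A *m delta_mx i j) = A j i.
Proof.
rewrite /mxtrace (bigD1 j)//= [X in _ + X]big1 => [|k kj]; rewrite mxE.
  rewrite (bigD1 i)//= big1 => [|l li]; rewrite !mxE ?eqxx ?mulr1 ?addr0//.
  by rewrite (negbTE li) mulr0.
by apply: big1 => l _; rewrite mxE (negbTE kj) andbF mulr0.
Qed.

(** In entry (i,j) the secant identity reads d (A1_ii G2_jj - M1_ij M2_ij). Squared row and column
    norms at most 1/5 force the diagonal entries to be at least 1 / (1 + 1/5) = 5/6, which also
    makes the slopes M_ij small. The bracket is then at least 1/2, and d^2 = 4 d2 compensates its
    square. *)
Lemma graph_slope_sep m r (W1 W2 : 'M[R]_(m, r)) (i : 'I_m) (j : 'I_r) (d d2 : R) :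
  (forall i j, W1 i j ^+ 2 = d2) -> (forall i j, W2 i j ^+ 2 = d2) ->
  W2 - W1 = d *: delta_mx i j -> d ^+ 2 = 4 * d2 ->
  m%:R * d2 <= 5^-1 -> r%:R * d2 <= 5^-1 ->
  d2 <= ((W2 *m graph_inv W2) i j - (W1 *m graph_inv W1) i j) ^+ 2.
Proof.
move=> h1 h2 e ed hm hr.
have d2ge0 : 0 <= d2 by rewrite -(h1 i j) sqr_ge0.
have ge (x : R) : 0 <= x -> x <= 5^-1 -> 5 / 6 <= (1 + x)^-1.
  by move=> x0 x5; rewrite -[leRHS]div1r ler_pdivlMr; lra.
have a1 : 5 / 6 <= graph_inv W1^T i i.
  apply: (le_trans (ge _ _ hr)); first by rewrite mulr_ge0.
  by apply: graph_inv_diag_ge => l; rewrite mxE.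
have a2 : 5 / 6 <= graph_inv W2^T i i.
  apply: (le_trans (ge _ _ hr)); first by rewrite mulr_ge0.
  by apply: graph_inv_diag_ge => l; rewrite mxE.
have b2 : 5 / 6 <= graph_inv W2 j j.
  apply: (le_trans (ge _ _ hm)); first by rewrite mulr_ge0.
  exact: graph_inv_diag_ge.
have x1 := graph_slope_entry_sq W1 i j.
have x2 := graph_slope_entry_sq W2 i j.
have /andP[_ a1'] := graph_inv_diag_le1 W1^T i.
have /andP[_ a2'] := graph_inv_diag_le1 W2^T i.
rewrite -mxBE graph_slope_secant e [(d *: _)^T]linearZ /= trmx_delta.
rewrite -!scalemxAr -!scalemxAl -scalerBr mxZE mxBE exprMn ed.
have -> (A : 'M[R]_m) (B : 'M[R]_r) : (A *m delta_mx i j *m B) i j = A i i * B j j.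
  exact: mulmx_delta_entry.
have -> (A B : 'M[R]_(m, r)) : (A *m delta_mx j i *m B) i j = A i j * B i j.
  exact: mulmx_delta_entry.
move: x1 x2 a1 a2 a1' a2' b2.
move: ((_ *m _) i j) ((_ *m _) i j).
move: (graph_inv _ i i) (graph_inv _ i i) (graph_inv _ j j).
move=> a a' b x y x1 x2 a1 a2 a1' a2' b2.
have ab : 25 / 36 <= a' * b.
  by rewrite (_ : 25 / 36 = 5 / 6 * (5 / 6)) ?ler_pM//; lra.
have s1 : 0 <= (1 - a) ^+ 2 by exact: sqr_ge0.
have s2 : 0 <= (1 - a') ^+ 2 by exact: sqr_ge0.
have s3 : 0 <= (y - x) ^+ 2 by exact: sqr_ge0.
(* From (1 - a)^2 >= 0 follows a - a^2 <= 1 - a <= 1/6, and likewise for a'. Hence y x <= (x^2 +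
   y^2) / 2 <= 1/6, and 25/36 - 1/6 = 19/36 exceeds 1/2. *)
have : 1 / 2 <= a' * b - y * x by nra.
by move: (_ - y * x) => u hu; rewrite [4 * _]mulrC -mulrA ler_peMr//; nra.
Qed.

(** The Cholesky factor of the Gram matrix Z'Z = L L' of the graph matrix Z orthonormalises its
    columns: V = Z (L')^-1. *)
Lemma graph_frame m r (W : 'M[R]_(m, r)) :
  exists2 V : 'M[R]_(r + m, r),
    orthonormal_frame V & V *m V^T = graph_proj W.
Proof.
have [L uL e] := cholesky (posdef_1D_gram W).
have iL := upper_pos_unit uL.
have iLT : L^T \in unitmx by rewrite unitmx_tr.
exists (graph_mx W *m invmx L^T).
  rewrite /orthonormal_frame trmx_mul mulmxA -(mulmxA _ _^T) graph_gramE e.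
  by rewrite trmx_inv trmxK mulKmx// mulmxV.
rewrite /graph_proj trmx_mul mulmxA -(mulmxA (graph_mx W)); congr (_ *m _ *m _).
have u := posdef_unit (posdef_1D_gram W).
apply: (can_inj (mulmxK u)); rewrite mulVmx// e trmx_inv trmxK.
by rewrite -mulmxA mulKmx// mulVmx.
Qed.

Lemma graph_proj_slope m r (W : 'M[R]_(m, r)) i j :
  graph_proj W (rshift r i) (lshift m j) = (W *m graph_inv W) i j.
Proof.
rewrite /graph_proj /graph_mx mul_col_mx tr_col_mx mul_col_row mul1mx trmx1.
by rewrite block_mxEdl !mulmx1.
Qed.

(** V V' and 1 - V V' are both of the form B B', the latter because it is a symmetric idempotent, so
    their diagonals are nonnegative. *)
Lemma frame_diag_le1 k r (V : 'M[R]_(k, r)) i :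
  orthonormal_frame V -> 0 <= 1 - (V *m V^T) i i <= 1.
Proof.
move=> oV; rewrite gerBl row_normsq_ge0 andbT.
have e : 1%:M - V *m V^T = (1%:M - V *m V^T) *m (1%:M - V *m V^T)^T.
  rewrite linearB /= trmx1 trmx_mul trmxK mulmxBl mul1mx mulmxBr mulmx1.
  by rewrite mulmxA -(mulmxA V) oV mulmx1 subrr subr0.
by have := row_normsq_ge0 (1%:M - V *m V^T) i; rewrite -e mxBE mxE eqxx.
Qed.

Lemma frame_trace k r (V : 'M[R]_(k, r)) :
  orthonormal_frame V -> \tr (V *m V^T) = r%:R.
Proof. by move=> oV; rewrite mxtrace_mulC oV mxtrace1. Qed.

(** With Q = 1 - P1 the left side is tr (Q P2 Q). Q annihilates the graph matrix of W1, so Q applied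
    to that of W2 only sees the single changed entry, and the trace collapses to d^2 times a
    diagonal entry of Q times one of [graph_inv W2], both in [0, 1]. *)
Lemma graph_overlap m r (W1 W2 : 'M[R]_(m, r)) (V1 V2 : 'M[R]_(r + m, r))
    (i : 'I_m) (j : 'I_r) (d : R) :
  orthonormal_frame V1 -> V1 *m V1^T = graph_proj W1 ->
  orthonormal_frame V2 -> V2 *m V2^T = graph_proj W2 ->
  W2 - W1 = d *: delta_mx i j ->
  r%:R - \tr (V1 *m V1^T *m (V2 *m V2^T)) <= d ^+ 2.
Proof.
move=> o1 e1 o2 e2 e; set P1 := V1 *m V1^T; set P2 := V2 *m V2^T.
have sP1 : P1^T = P1 by rewrite trmx_mul trmxK.
have P1P1 : P1 *m P1 = P1 by rewrite /P1 mulmxA -(mulmxA V1) o1 mulmx1.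
have PZ : P1 *m graph_mx W1 = graph_mx W1.
  rewrite /P1 e1 /graph_proj -mulmxA graph_gramE -mulmxA mulVmx ?mulmx1//.
  exact: posdef_unit (posdef_1D_gram W1).
pose Q := 1%:M - P1.
have sQ : Q^T = Q by rewrite linearB /= trmx1 sP1.
have QQ : Q *m Q = Q.
  by rewrite /Q mulmxBr mulmx1 mulmxBl mul1mx P1P1 subrr subr0.
pose D : 'M[R]_(r + m, r) := d *: delta_mx (rshift r i) j.
have ZD : graph_mx W2 = graph_mx W1 + D.
  have -> : W2 = W1 + d *: delta_mx i j by rewrite -e addrC subrK.
  rewrite /graph_mx /D -[1%:M in LHS]addr0 -add_col_mx; congr (_ + _).
  apply/matrixP => a b; rewrite !mxE; case: (split_ordP a) => a' ->.
    by rewrite mxE eq_lrshift mulr0.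
  by rewrite !mxE eq_rshift.
have QZ : Q *m graph_mx W2 = Q *m D.
  by rewrite ZD mulmxDr [Q *m graph_mx W1]mulmxBl mul1mx PZ subrr add0r.
have -> : r%:R - \tr (P1 *m P2) = \tr (Q *m P2 *m Q).
  rewrite -(frame_trace o2) -/P2 [RHS]mxtrace_mulC [Q *m (Q *m _)]mulmxA QQ
    mulmxBl mul1mx.
  by rewrite linearB.
have -> : Q *m P2 *m Q = Q *m D *m graph_inv W2 *m D^T *m Q.
  have ZQ : (graph_mx W2)^T *m Q = D^T *m Q.
    by rewrite -{1}sQ -trmx_mul QZ trmx_mul sQ.
  by rewrite [P2]e2 /graph_proj !mulmxA QZ -(mulmxA _ _^T Q) ZQ !mulmxA.
rewrite mxtrace_mulC !mulmxA QQ.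
rewrite /D [(d *: _)^T]linearZ /= trmx_delta -!scalemxAr -!scalemxAl.
rewrite scalerA mxtraceZ -expr2.
have -> : \tr (Q *m delta_mx (rshift r i) j *m graph_inv W2 *m delta_mx j (rshift r i))
   = Q (rshift r i) (rshift r i) * graph_inv W2 j j.
  by rewrite mxtrace_mul_delta mulmx_delta_entry.
rewrite /Q mxBE [1%:M _ _]mxE eqxx.
have /andP[q0 q1] := frame_diag_le1 (rshift r i) o1.
have /andP[b0 b1] := graph_inv_diag_le1 W2 j.
by rewrite ler_piMr ?sqr_ge0// mulr_ile1.
Qed.
End GraphProjector.

(** * Spiked covariances with equal spikes *)

Section Spike.
Context {R : realType} (k r : nat) (lam : R) (lam0 : 0 < lam).
Implicit Type V : 'M[R]_(k, r).

Lemma spiked_cov_const V :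
  spiked_cov V (fun=> lam) = lam *: (V *m V^T) + 1%:M.
Proof.
rewrite /spiked_cov; have -> : \row_(i < r) lam = const_mx lam.
  by apply/rowP => i; rewrite !mxE.
by rewrite diag_const_mx mul_mx_scalar -scalemxAl.
Qed.

Lemma posdef_spiked V : posdef (spiked_cov V (fun=> lam)).
Proof.
have := posdef_1D_gram (Num.sqrt lam *: V^T).
rewrite spiked_cov_const addrC [(_ *: _)^T]linearZ /= trmxK.
by rewrite -scalemxAl -scalemxAr scalerA -expr2 sqr_sqrtr// ltW.
Qed.

Lemma invmx_spiked V : orthonormal_frame V ->
  invmx (spiked_cov V (fun=> lam)) = 1%:M - (lam / (1 + lam)) *: (V *m V^T).
Proof.
move=> oV; have u := posdef_unit (posdef_spiked V).
apply: (can_inj (mulKmx u)); rewrite mulmxV// spiked_cov_const.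
have PP : V *m V^T *m (V *m V^T) = V *m V^T.
  by rewrite mulmxA -(mulmxA V) oV mulmx1.
rewrite mulmxBr mulmx1 -scalemxAr mulmxDl mul1mx -scalemxAl PP.
apply/matrixP => i j; move: (V *m V^T) => P; rewrite !mxE.
by field; rewrite gt_eqF// addr_gt0.
Qed.

(** The first half contributes k / 2. In the second, tr ((1 + lam P1) (1 - lam / (1 + lam) P2))
    equals k + h (r - tr (P1 P2)), since lam - lam / (1 + lam) = lam^2 / (1 + lam) = h. *)
Lemma spiked_mid_trace V1 V2 : orthonormal_frame V1 -> orthonormal_frame V2 ->
  \tr (spiked_cov V1 (fun=> lam) *m
       (2^-1 *: (invmx (spiked_cov V1 (fun=> lam)) +
                 invmx (spiked_cov V2 (fun=> lam))))) - k%:R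
  = hfun lam / 2 * (r%:R - \tr (V1 *m V1^T *m (V2 *m V2^T))).
Proof.
move=> o1 o2; have u := posdef_unit (posdef_spiked V1).
rewrite -scalemxAr mulmxDr mulmxV// (invmx_spiked o2) spiked_cov_const.
rewrite mulmxBr mulmx1 -scalemxAr mulmxDl mul1mx -scalemxAl.
rewrite mxtraceZ 2!mxtraceD mxtrace1 linearN /= mxtraceD !mxtraceZ mxtrace1.
rewrite mxtraceD mxtraceZ !frame_trace// /hfun.
move: (\tr _) => t.
by field; rewrite gt_eqF// addr_gt0.
Qed.
End Spike.

(** * Iterated Lebesgue integrals *)

Section IteratedIntegral.
Context {R : realType}.
Implicit Type m : nat.

(** The parameter space is arbitrary so that the induction can move one tuple coordinate at a time
    into it; Tonelli then integrates that coordinate out. *)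
Lemma measurable_leb_int_param d (T : measurableType d) m
    (f : T * m.-tuple R -> \bar R) :
  measurable_fun [set: T * m.-tuple R] f -> (forall p, (0 <= f p)%E) ->
  measurable_fun [set: T] (fun t => leb_int (fun v => f (t, v))) /\
  (forall t, (0 <= leb_int (fun v => f (t, v)))%E).
Proof.
elim: m d T f => [|m IH] d T f mf f0 /=.
  by split=> //; apply: measurableT_comp mf _; exact: measurable_fun_pair.
pose f' (p : T * R * m.-tuple R) := f (p.1.1, cons_tuple p.1.2 p.2).
have mf' : measurable_fun [set: T * R * m.-tuple R] f'.
  apply: measurableT_comp mf _; apply: measurable_fun_pair.
    exact: measurableT_comp measurable_fst measurable_fst.
  apply: measurable_cons => //.
  exact: measurableT_comp measurable_snd measurable_fst.
have [mg g0] := IH _ _ _ mf' (fun p => f0 _).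
split; last by move=> t; apply: integral_ge0 => x _; exact: (g0 (t, x)).
exact: (@measurable_fun_fubini_tonelli_F _ _ _ _ _ (@lebesgue_measure R) _ mg g0).
Qed.

Lemma measurable_leb_int_cons m (f : m.+1.-tuple R -> \bar R) :
  measurable_fun [set: m.+1.-tuple R] f -> (forall p, (0 <= f p)%E) ->
  measurable_fun [set: R] (fun x => leb_int (fun v => f (cons_tuple x v))) /\
  (forall x, (0 <= leb_int (fun v => f (cons_tuple x v)))%E).
Proof.
move=> mf f0.
apply: (@measurable_leb_int_param _ R m (fun p => f (cons_tuple p.1 p.2))) => //.
by apply: measurableT_comp mf _; exact: measurable_cons.
Qed.

Lemma measurable_cons_tuple m (f : m.+1.-tuple R -> \bar R) (x : R) :
  measurable_fun [set: m.+1.-tuple R] f ->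
  measurable_fun [set: m.-tuple R] (fun v => f (cons_tuple x v)).
Proof. by move=> mf; apply: measurableT_comp mf _; exact: measurable_cons. Qed.

Lemma leb_int_ge0 m (f : m.-tuple R -> \bar R) :
  (forall p, (0 <= f p)%E) -> (0 <= leb_int f)%E.
Proof.
elim: m f => [|m IH] f f0 /=; first exact: f0.
by apply: integral_ge0 => x _; exact: IH.
Qed.

Lemma le_leb_int m (f g : m.-tuple R -> \bar R) :
  measurable_fun [set: m.-tuple R] f -> (forall p, (0 <= f p)%E) ->
  measurable_fun [set: m.-tuple R] g -> (forall p, (f p <= g p)%E) ->
  (leb_int f <= leb_int g)%E.
Proof.
elim: m f g => [|m IH] f g mf f0 mg fg /=; first exact: fg.
have g0 p : (0 <= g p)%E by exact: le_trans (f0 p) (fg p).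
have [mF F0] := measurable_leb_int_cons mf f0.
have [mG G0] := measurable_leb_int_cons mg g0.
apply: ge0_le_integral => //= x _.
by apply: IH => //; exact: measurable_cons_tuple.
Qed.

Lemma leb_intD m (f g : m.-tuple R -> \bar R) :
  measurable_fun [set: m.-tuple R] f -> (forall p, (0 <= f p)%E) ->
  measurable_fun [set: m.-tuple R] g -> (forall p, (0 <= g p)%E) ->
  leb_int (fun p => f p + g p)%E = (leb_int f + leb_int g)%E.
Proof.
elim: m f g => [//|m IH] f g mf f0 mg g0 /=.
have [mF F0] := measurable_leb_int_cons mf f0.
have [mG G0] := measurable_leb_int_cons mg g0.
rewrite -ge0_integralD//; apply: eq_integral => x _.
by rewrite IH//; exact: measurable_cons_tuple.
Qed.

Lemma leb_intZ m (f : m.-tuple R -> \bar R) (c : R) :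
  measurable_fun [set: m.-tuple R] f -> (forall p, (0 <= f p)%E) -> 0 <= c ->
  leb_int (fun p => c%:E * f p)%E = (c%:E * leb_int f)%E.
Proof.
elim: m f => [//|m IH] f mf f0 c0 /=.
have [mF F0] := measurable_leb_int_cons mf f0.
rewrite -ge0_integralZl_EFin//; apply: eq_integral => x _.
by rewrite IH//; exact: measurable_cons_tuple.
Qed.

Lemma eq_leb_int m (f g : m.-tuple R -> \bar R) : f =1 g -> leb_int f = leb_int g.
Proof. by move=> /funext ->. Qed.

Lemma leb_int0 m : leb_int (fun _ : m.-tuple R => 0%E) = 0%E.
Proof. by elim: m => [//|m /= ->]; exact: integral0. Qed.

Lemma leb_int_sum m (I : Type) (s : seq I) (f : I -> m.-tuple R -> \bar R) :
  (forall i, measurable_fun [set: m.-tuple R] (f i)) ->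
  (forall i p, (0 <= f i p)%E) ->
  leb_int (fun p => \sum_(i <- s) f i p)%E = (\sum_(i <- s) leb_int (f i))%E.
Proof.
move=> mf f0; elim: s => [|i s IH].
  by rewrite big_nil -[RHS](leb_int0 m); apply: eq_leb_int => p; rewrite big_nil.
rewrite big_cons -IH -leb_intD//.
- by apply: eq_leb_int => p; rewrite big_cons.
- exact: emeasurable_sum.
- by move=> p; apply: sume_ge0.
Qed.

End IteratedIntegral.

(** * Measurability of matrix-valued maps *)

Section MeasurableMatrix.
Context {R : realType} {d : measure_display} {T : measurableType d}.

Definition measurable_mx m p (F : T -> 'M[R]_(m, p)) :=
  forall i j, measurable_fun [set: T] (fun t => F t i j).

Lemma measurable_mx_cst m p (A : 'M[R]_(m, p)) : measurable_mx (fun=> A).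
Proof. by move=> i j; exact: measurable_cst. Qed.

Lemma measurable_mx_tr m p (F : T -> 'M[R]_(m, p)) :
  measurable_mx F -> measurable_mx (fun t => (F t)^T).
Proof. by move=> mF i j; under eq_fun do rewrite mxE; exact: mF. Qed.

Lemma measurable_mxB m p (F G : T -> 'M[R]_(m, p)) :
  measurable_mx F -> measurable_mx G -> measurable_mx (fun t => F t - G t).
Proof.
by move=> mF mG i j; under eq_fun do rewrite mxBE; exact: measurable_funB.
Qed.

Lemma measurable_mxM m p q (F : T -> 'M[R]_(m, p)) (G : T -> 'M[R]_(p, q)) :
  measurable_mx F -> measurable_mx G -> measurable_mx (fun t => F t *m G t).
Proof.
move=> mF mG i j; under eq_fun do rewrite mxE.
by apply: measurable_sum => l; exact: measurable_funM.
Qed.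

Lemma measurable_frob2 m p (F : T -> 'M[R]_(m, p)) :
  measurable_mx F -> measurable_fun [set: T] (fun t => frob2 (F t)).
Proof.
move=> mF; apply: measurable_sum => i; apply: measurable_sum => j.
exact: measurable_funX.
Qed.
End MeasurableMatrix.

(** * Gaussian integrals *)

Section GaussianIntegral.
Context {R : realType}.

(** The integrand is the normal density of mean mu / l and standard deviation 1 / l, divided by its
    peak value. *)
Lemma integral_expR_sqr (l mu : R) : 0 < l ->
  (\int[@lebesgue_measure R]_x (expR (- (x * l - mu) ^+ 2 / 2))%:E =
   (Num.sqrt (pi *+ 2) / l)%:E)%E.
Proof.
move=> l0; have l1 : l^-1 != 0 by rewrite invr_neq0// gt_eqF.
have p0 := normal_peak_gt0 l1.
transitivity (\int[@lebesgue_measure R]_x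
   ((normal_peak l^-1)^-1%:E * (normal_pdf (mu / l) l^-1 x)%:E))%E.
  apply: eq_integral => x _; rewrite -EFinM normal_pdfE//=.
  rewrite mulKf ?gt_eqF// /normal_fun; congr (expR _)%:E.
  by field; rewrite gt_eqF.
rewrite ge0_integralZl_EFin ?invr_ge0 ?(ltW p0)//.
- rewrite integral_normal_pdf mule1 /normal_peak invrK; congr EFin.
  rewrite -mulrnAr sqrtrM ?sqr_ge0// sqrtr_sqr ger0_norm ?invr_ge0 ?ltW//.
  by rewrite mulrC.
- by move=> x _; rewrite lee_fin normal_pdf_ge0.
- by apply/measurable_EFinP; exact: measurable_normal_pdf.
Qed.

Definition tup2row N (t : N.-tuple R) : 'rV[R]_N := \row_i tnth t i.

Definition normsq N (x : 'rV[R]_N) : R := (x *m x^T) 0 0.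

Lemma normsq_row_mx N (a : 'M[R]_1) (x : 'rV[R]_N) :
  normsq (row_mx a x : 'rV[R]_(1 + N)) = a 0 0 ^+ 2 + normsq x.
Proof.
by rewrite /normsq tr_row_mx mul_row_col mxE mx11_trE [X in X + _]mxE big_ord1 expr2.
Qed.

Lemma measurable_tup2row N : measurable_mx (@tup2row N).
Proof.
by move=> i j; under eq_fun do rewrite mxE; exact: measurable_tnth.
Qed.

Lemma measurable_gauss_row N (L : 'M[R]_N) mu :
  measurable_fun [set: N.-tuple R]
    (fun t => (expR (- normsq (tup2row t *m L - mu) / 2))%:E).
Proof.
apply/measurable_EFinP; apply: measurableT_comp => //.
apply: measurable_funM => //; apply: measurableT_comp => //.
have m1 : measurable_mx (fun t => tup2row t *m L - mu).
  apply: measurable_mxB (measurable_mx_cst _).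
  exact: measurable_mxM (@measurable_tup2row N) (measurable_mx_cst _).
by apply: (measurable_mxM m1 (measurable_mx_tr m1)).
Qed.

Lemma tup2row_cons N x (v : N.-tuple R) :
  tup2row (cons_tuple x v) = row_mx (x%:M : 'M[R]_1) (tup2row v).
Proof.
apply/rowP => i; rewrite mxE; case: (@split_ordP 1 N i) => j ->.
  by rewrite (@row_mxEl R 1 1 N) mxE ord1 eqxx mulr1n.
rewrite (@row_mxEr R 1 1 N) mxE (tnth_nth 0) [RHS](tnth_nth 0) /=.
by [].
Qed.

(** The shift [mu] is there for the induction: with the first coordinate fixed at x, the remaining
    ones are centred at m2 - x w, and their integral does not depend on that centre. A
    one-dimensional Gaussian integral in x is left. *)
Lemma gauss_leb_int N (L : 'M[R]_N) (mu : 'rV[R]_N) : upper_pos L ->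
  leb_int (fun t : N.-tuple R => (expR (- normsq (tup2row t *m L - mu) / 2))%:E)
  = (\prod_i (Num.sqrt (pi *+ 2) / L i i))%:E.
Proof.
elim: N L mu => [|N IH] L mu.
  move=> _ /=; rewrite big_ord0 /normsq mxE big_ord0 oppr0 mul0r expR0 //.
case; rewrite -[L](@submxK R 1 N 1 N) -[mu](@hsubmxK R 1 1 N).
set l := ulsubmx _; set w := ursubmx _; set z := dlsubmx _; set L2 := drsubmx _.
set m1 := lsubmx _; set m2 := rsubmx _ => u p.
have z0 : z = 0.
  apply/matrixP => i j; have := u (rshift 1 i) (lshift N j).
  by rewrite (@block_mxEdl R 1 N 1 N) => h; rewrite [RHS]mxE; apply: h; rewrite ord1.
have uL2 : upper_pos L2.
  split=> [i j ji|i].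
    have := u (rshift 1 i) (rshift 1 j).
    by rewrite (@block_mxEdr R 1 N 1 N); apply; rewrite /= ltn_add2l.
  by have := p (rshift 1 i); rewrite (@block_mxEdr R 1 N 1 N).
have l0 : 0 < l 0 0.
  by have := p (lshift N (0 : 'I_1)); rewrite (@block_mxEul R 1 N 1 N).
rewrite big_ord_recl /=.
have -> : (ord0 : 'I_N.+1) = lshift N (0 : 'I_1) by apply/val_inj.
rewrite (@block_mxEul R 1 N 1 N).
under [X in _ * X]eq_bigr => i _.
  have -> : lift (lshift N (0 : 'I_1)) i = rshift 1 i by apply/val_inj.
  rewrite (@block_mxEdr R 1 N 1 N).
  over.
set K := \prod_i _.
transitivity (\int[@lebesgue_measure R]_x
   ((expR (- (x * l 0 0 - m1 0 0) ^+ 2 / 2))%:E * K%:E))%E.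
  apply: eq_integral => x _; rewrite -(IH L2 (m2 - x *: w) uL2) -leb_intZ.
  - apply: eq_leb_int => t; rewrite tup2row_cons z0 -EFinM -expRD.
    rewrite (@mul_row_block R 1 1 N 1 N) mulmx0 addr0.
    rewrite (@opp_row_mx R 1 1 N) (@add_row_mx R 1 1 N).
    rewrite (normsq_row_mx (_ - _)) -mulrDl -opprD mxBE mul_scalar_mx mxZE.
    congr (expR (- (_ + normsq _) / 2))%:E.
    by rewrite mul_scalar_mx opprB addrA [x *: w + _]addrC.
  - exact: measurable_gauss_row.
  - by move=> t; rewrite lee_fin expR_ge0.
  - exact: expR_ge0.
have K0 : 0 <= K.
  apply: prodr_ge0 => i _; rewrite divr_ge0 ?sqrtr_ge0//.
  by case: uL2 => _ /(_ i) /ltW.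
under eq_integral do rewrite muleC.
rewrite ge0_integralZl_EFin//.
- by rewrite integral_expR_sqr// -EFinM mulrC.
- apply/measurable_EFinP; apply: measurableT_comp => //.
  apply: measurable_funM => //; apply: measurableT_comp => //.
  by apply: measurable_funX; apply: measurable_funB => //; exact: measurable_funM.
Qed.


(** * Row-major flattening of matrices *)

Lemma index_allpairs (S T : eqType) (s : seq S) (t : seq T) x y :
  x \in s -> y \in t ->
  index (x, y) [seq (a, b) | a <- s, b <- t] = (index x s * size t + index y t)%N.
Proof.
elim: s => [//|a s IH]; rewrite inE => xs yt; rewrite allpairs_cons index_cat.
have [<-|ax] := eqVneq a x.
  rewrite mem_map ?yt; last by move=> u v [].
  by rewrite /= eqxx index_map // => u v [].
case: ifP => [/mapP[b _ [xa _]]|_]; first by rewrite xa eqxx in ax.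
rewrite IH//; last by move: xs; rewrite eq_sym (negbTE ax).
by rewrite size_map /= (negbTE ax) mulSn addnA.
Qed.

(** Pairs are enumerated as the list of all pairs of the two enumerations, rows first. The explicit
    position is what shows that flattening keeps triangular structure. *)
Lemma val_mxvec_index n k (i : 'I_n) (j : 'I_k) :
  val (mxvec_index i j) = (i * k + j)%N.
Proof.
rewrite /mxvec_index /=.
set x := (i, j); have xT : (enum_rank x < size (enum {: 'I_n * 'I_k}))%N.
  by rewrite -cardE ltn_ord.
rewrite -(index_uniq x xT (enum_uniq _)) nth_enum_rank.
rewrite enumT unlock index_allpairs ?mem_enum//.
by rewrite size_enum_ord !index_enum_ord.
Qed.

Lemma lin_mulmxr_entry n k (L : 'M[R]_k) (a a' : 'I_n) (b b' : 'I_k) :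
  lin_mulmxr L (mxvec_index a b) (mxvec_index a' b') = (a == a')%:R * L b b'.
Proof.
rewrite /lin_mulmxr /lin_mx /lin1_mx mxE /= vec_mx_delta mxvecE.
rewrite mxE (bigD1 b)//= big1 ?addr0 => [|c cb]; rewrite mxE.
  by rewrite eqxx andbT eq_sym.
by rewrite (negbTE cb) andbF mul0r.
Qed.

Lemma prod_mxvec n k (F : 'I_(n * k) -> R) :
  \prod_i F i = \prod_(a < n) \prod_(b < k) F (mxvec_index a b).
Proof.
rewrite pair_bigA /= (reindex (uncurry (@mxvec_index n k))) /=.
  by apply: eq_bigr => [[a b]].
exact: curry_mxvec_bij.
Qed.
End GaussianIntegral.

(** * Affinity of Gaussian samples *)

Section GaussianDensity.
Context {R : realType}.

(* [mxvec] is row-major, so [lin_mulmxr L] is block diagonal with n blocks L. *)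
Lemma upper_pos_lin_mulmxr n k (L : 'M[R]_k) : upper_pos L ->
  upper_pos (lin_mulmxr L : 'M[R]_(n * k)).
Proof.
case=> u p; split=> [x y|x].
  case/mxvec_indexP: x => a b; case/mxvec_indexP: y => a' b'.
  rewrite !val_mxvec_index lin_mulmxr_entry.
  have [<-|] := eqVneq a a'; last by rewrite mul0r.
  by rewrite ltn_add2l => /u ->; rewrite mulr0.
by case/mxvec_indexP: x => a b; rewrite lin_mulmxr_entry eqxx mul1r.
Qed.

Lemma tup2rowE n k (t : (n * k).-tuple R) : tup2row t = mxvec (tup2mx t).
Proof.
by apply/rowP => x; case/mxvec_indexP: x => a b; rewrite mxvecE !mxE.
Qed.

Lemma normsq_mxvec n k (Y : 'M[R]_(n, k)) :
  normsq (mxvec Y) = \sum_i normsq (row i Y).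
Proof.
rewrite /normsq mulmx_tr_diag (reindex (uncurry (@mxvec_index n k)))/=; last first.
  exact: curry_mxvec_bij.
rewrite (eq_bigr (fun p => Y p.1 p.2 ^+ 2)) => [|[a b] _]; last by rewrite /= mxvecE.
rewrite -(pair_bigA _ (fun a b => Y a b ^+ 2))/=; apply: eq_bigr => a _.
by rewrite mulmx_tr_diag; apply: eq_bigr => b _; rewrite mxE.
Qed.

Definition qf_rows n k (G : 'M[R]_k) (X : 'M[R]_(n, k)) : R :=
  \sum_i qf G (row i X).

(** With G = L L' the exponent is the squared norm of the flattened X L, a single Gaussian integral
    in n k variables with a triangular factor. Its diagonal repeats that of L n times, and det G is
    the square of the product of the L_ii. *)
Lemma gauss_precision n k (G : 'M[R]_k) : posdef G ->
  leb_int (fun t : (n * k).-tuple R => (expR (- qf_rows G (tup2mx t) / 2))%:E)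
  = (Num.sqrt ((pi *+ 2) ^+ k / \det G) ^+ n)%:E.
Proof.
move=> /cholesky[L uL ->].
have := gauss_leb_int 0 (@upper_pos_lin_mulmxr n k _ uL).
under eq_leb_int => t.
  rewrite subr0 tup2rowE mul_vec_lin /= normsq_mxvec.
  over.
move=> e.
transitivity (leb_int (fun t : (n * k).-tuple R =>
    (expR (- (\sum_i normsq (row i (tup2mx t *m L))) / 2))%:E)).
  apply: eq_leb_int => t; congr (expR (- _ / 2))%:E; apply: eq_bigr => i _.
  by rewrite /qf /normsq row_mul trmx_mul !mulmxA.
rewrite e prod_mxvec; congr EFin.
under eq_bigr do under eq_bigr do rewrite lin_mulmxr_entry eqxx mul1r.
rewrite prodr_const card_ord; congr (_ ^+ n).
have [u p] := uL; have P0 : 0 < \prod_i L i i by exact: prodr_gt0.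
rewrite big_split /= prodr_const card_ord prodfV det_mulmx det_tr det_upper// -expr2.
apply/eqP.
rewrite -(@eqrXn2 _ 2)// ?sqrtr_ge0 ?divr_ge0 ?exprn_ge0 ?sqrtr_ge0 ?(ltW P0)//.
have u0 : 0 <= pi *+ 2 :> R by rewrite mulrn_wge0// pi_ge0.
rewrite sqr_sqrtr ?divr_ge0 ?exprn_ge0 ?(ltW P0)//.
by rewrite exprMn exprVn -exprM mulnC exprM sqr_sqrtr.
Qed.

Definition norm_const k (Sigma : 'M[R]_k) : R :=
  (Num.sqrt ((pi *+ 2) ^+ k * \det Sigma))^-1.

Lemma norm_const_gt0 k (Sigma : 'M[R]_k) : posdef Sigma -> 0 < norm_const Sigma.
Proof.
move=> /posdef_det/andP[d0 _]; rewrite invr_gt0 sqrtr_gt0 mulr_gt0// exprn_gt0//.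
by rewrite mulrn_wgt0// pi_gt0.
Qed.

Lemma data_densityE n k (Sigma : 'M[R]_k) (X : 'M[R]_(n, k)) :
  data_density Sigma X =
  norm_const Sigma ^+ n * expR (- qf_rows (invmx Sigma) X / 2).
Proof.
rewrite /data_density /gauss_density big_split /= prodr_const card_ord -expR_sum.
by rewrite -mulr_suml sumrN.
Qed.

Lemma data_density_gt0 n k (Sigma : 'M[R]_k) (X : 'M[R]_(n, k)) :
  posdef Sigma -> 0 < data_density Sigma X.
Proof.
by move=> pS; rewrite data_densityE mulr_gt0 ?expR_gt0// exprn_gt0// norm_const_gt0.
Qed.

Lemma measurable_tup2mx n k : measurable_mx (@tup2mx R n k).
Proof.
by move=> i j; under eq_fun do rewrite mxE; exact: measurable_tnth.
Qed.

Lemma measurable_expR_qf_rows n k (G : 'M[R]_k) :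
  measurable_fun [set: (n * k).-tuple R]
    (fun t => expR (- qf_rows G (tup2mx t : 'M[R]_(n, k)) / 2)).
Proof.
apply: measurableT_comp => //; apply: measurable_funM => //.
apply: measurableT_comp => //; apply: measurable_sum => i.
have mrow : measurable_mx (fun t => row i (tup2mx t : 'M[R]_(n, k))).
  by move=> a b; under eq_fun do rewrite mxE; exact: measurable_tup2mx.
exact: (measurable_mxM (measurable_mxM mrow (measurable_mx_cst _))
  (measurable_mx_tr mrow)).
Qed.

Lemma measurable_data_density n k (Sigma : 'M[R]_k) :
  measurable_fun [set: (n * k).-tuple R]
    (fun t => data_density Sigma (tup2mx t : 'M[R]_(n, k))).
Proof.
under eq_fun do rewrite data_densityE.
by apply: measurable_funM => //; exact: measurable_expR_qf_rows.
Qed.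

Lemma leb_int_cst_expR_qf_rows n k (c : R) (G : 'M[R]_k) : 0 <= c -> posdef G ->
  leb_int (fun t : (n * k).-tuple R => (c * expR (- qf_rows G (tup2mx t) / 2))%:E)
  = (c * Num.sqrt ((pi *+ 2) ^+ k / \det G) ^+ n)%:E.
Proof.
move=> c0 pG; rewrite EFinM -gauss_precision// -leb_intZ//.
by apply/measurable_EFinP; exact: measurable_expR_qf_rows.
Qed.

Lemma leb_int_data_density n k (Sigma : 'M[R]_k) : posdef Sigma ->
  leb_int (fun t : (n * k).-tuple R => (data_density Sigma (tup2mx t))%:E) = 1%E.
Proof.
move=> pS; have pi := posdef_inv pS.
under eq_leb_int do rewrite data_densityE.
rewrite leb_int_cst_expR_qf_rows//; last by rewrite exprn_ge0// ltW// norm_const_gt0.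
rewrite det_inv invrK -exprMn mulVf ?expr1n//.
by rewrite -invr_eq0 gt_eqF// norm_const_gt0.
Qed.

(** Precision matrix of the normalised geometric mean of the two centred Gaussian densities. *)
Definition mid_precision k (S1 S2 : 'M[R]_k) : 'M[R]_k :=
  2^-1 *: (invmx S1 + invmx S2).

Lemma sqrt_data_density n k (S1 S2 : 'M[R]_k) (X : 'M[R]_(n, k)) :
  posdef S1 -> posdef S2 ->
  Num.sqrt (data_density S1 X * data_density S2 X) =
  Num.sqrt (norm_const S1 * norm_const S2) ^+ n *
  expR (- qf_rows (mid_precision S1 S2) X / 2).
Proof.
move=> p1 p2; have c1 := norm_const_gt0 p1; have c2 := norm_const_gt0 p2.
rewrite !data_densityE mulrACA -exprMn -expRD.
have -> : - qf_rows (invmx S1) X / 2 + - qf_rows (invmx S2) X / 2 =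
    - qf_rows (mid_precision S1 S2) X / 2 * 2.
  rewrite divfK// -mulrDl -opprD mulNr; congr (- _).
  rewrite /qf_rows -big_split /= mulr_suml; apply: eq_bigr => i _.
  rewrite /qf /mid_precision -scalemxAr -scalemxAl mulmxDr mulmxDl mxZE.
  by rewrite [in RHS]mxE mulrC.
set x := _ / 2; rewrite mulr_natr mulr2n expRD -expr2.
rewrite -{1}[norm_const _ * _]sqr_sqrtr; last by rewrite mulr_ge0// ltW.
by rewrite -exprM mulnC exprM -exprMn sqrtr_sqr ger0_norm.
Qed.

(** The fourth power of the one-sample affinity is 1 / (det (S1 G) det (S2 G)), and each determinant
    is at most exp a by [posdef_det_mul]. This gives exp (- a / 2) per sample. *)
Lemma affinity_ge n k (S1 S2 : 'M[R]_k) (a : R) : posdef S1 -> posdef S2 ->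
  \tr (S1 *m mid_precision S1 S2) - k%:R <= a ->
  \tr (S2 *m mid_precision S1 S2) - k%:R <= a ->
  ((expR (- a / 2) ^+ n)%:E <= leb_int (fun t : (n * k).-tuple R =>
    (Num.sqrt (data_density S1 (tup2mx t) * data_density S2 (tup2mx t)))%:E))%E.
Proof.
move=> p1 p2 t1 t2; set G := mid_precision S1 S2.
have pG : posdef G.
  by apply: posdefZ; rewrite ?invr_gt0//; apply: posdefD; exact: posdef_inv.
have c1 := norm_const_gt0 p1; have c2 := norm_const_gt0 p2.
under eq_leb_int do rewrite sqrt_data_density//.
rewrite leb_int_cst_expR_qf_rows ?exprn_ge0// lee_fin -exprMn.
have /andP[d1 _] := posdef_det p1; have /andP[d2 _] := posdef_det p2.
have /andP[dG _] := posdef_det pG.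
apply: lerXn2r; rewrite ?nnegrE ?expR_ge0 ?mulr_ge0 ?sqrtr_ge0//.
have u0 : 0 < (pi *+ 2) ^+ k :> R by rewrite exprn_gt0// mulrn_wgt0// pi_gt0.
rewrite -sqrtrM; last by rewrite mulr_ge0 ?ltW.
rewrite -(ger0_norm (expR_ge0 (- a / 2))) -sqrtr_sqr ler_wsqrtr//.
have -> : expR (- a / 2) ^+ 2 = expR (- a) by rewrite expr2 -expRD -splitr.
rewrite -(@ler_pXn2r _ 2)// ?nnegrE ?expR_ge0//; last first.
  by apply: ltW; apply: mulr_gt0; [exact: mulr_gt0 | exact: divr_gt0].
rewrite -/G.
have h1 : \det S1 * \det G <= expR a.
  by rewrite -det_mulmx; apply: le_trans (posdef_det_mul p1 pG) _; rewrite ler_expR.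
have h2 : \det S2 * \det G <= expR a.
  by rewrite -det_mulmx; apply: le_trans (posdef_det_mul p2 pG) _; rewrite ler_expR.
have -> : (norm_const S1 * norm_const S2 * ((pi *+ 2) ^+ k / \det G)) ^+ 2 =
    (\det S1 * \det G)^-1 * (\det S2 * \det G)^-1.
  rewrite !exprMn /norm_const !exprVn !sqr_sqrtr ?mulr_ge0 ?ltW//.
  by field; rewrite !gt_eqF.
rewrite expRN expr2; apply: ler_pM; rewrite ?invr_ge0 ?expR_ge0//.
  by rewrite lef_pV2 ?posrE ?expR_gt0 ?mulr_gt0.
by rewrite lef_pV2 ?posrE ?expR_gt0 ?mulr_gt0.
Qed.
End GaussianDensity.

(** * Assouad's lemma *)

Section Assouad.
Context {R : realType}.

(** Two-hypothesis testing bound at a fixed observation: a and b are the errors under weights p and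
    q. The free parameter u makes the bound linear in sqrt (p q), so it can be integrated term by
    term instead of applying Cauchy-Schwarz to integrals. *)
Lemma two_point_sq (p q a b u D : R) : 0 <= p -> 0 <= q -> 0 <= D ->
  D <= (b - a) ^+ 2 ->
  u * D * Num.sqrt (p * q) <= p * a ^+ 2 + q * b ^+ 2 + u ^+ 2 / 4 * D * (p + q).
Proof.
move=> p0 q0 D0 hD; rewrite sqrtrM//.
have [x xE] : {x : R | x ^+ 2 = p /\ Num.sqrt p = x}.
  by exists (Num.sqrt p); rewrite sqr_sqrtr.
have [y yE] : {y : R | y ^+ 2 = q /\ Num.sqrt q = y}.
  by exists (Num.sqrt q); rewrite sqr_sqrtr.
case: xE yE => <- -> [<- ->]; pose T := x ^+ 2 + y ^+ 2.
have T0 : 0 <= T by rewrite addr_ge0 ?sqr_ge0.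
have [Tz|Tn] := eqVneq T 0.
  have /andP[/eqP x0 /eqP y0] : (x == 0) && (y == 0).
    by move/eqP: Tz; rewrite paddr_eq0 ?sqr_ge0// !sqrf_eq0.
  by rewrite x0 y0 !(expr0n, mul0r, mulr0, addr0).
have Tp : 0 < T by rewrite lt0r Tn.
rewrite -(ler_pM2l Tp) -/T.
(* The exact form of Cauchy-Schwarz for the vectors (x a, - y b) and (y, x). *)
have e1 : T * (x ^+ 2 * a ^+ 2 + y ^+ 2 * b ^+ 2) =
    (x * y) ^+ 2 * (b - a) ^+ 2 + (x ^+ 2 * a + y ^+ 2 * b) ^+ 2.
  by rewrite /T; ring.
have e2 : (x * y) ^+ 2 * D <= (x * y) ^+ 2 * (b - a) ^+ 2.
  by rewrite ler_wpM2l ?sqr_ge0.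
(* This square gives (x y)^2 D / T >= u D x y - u^2 D T / 4, which trades the quotient for the
   linear term. *)
have e3 : 0 <= D * (x * y - u * T / 2) ^+ 2 by rewrite mulr_ge0 ?sqr_ge0.
have e4 : 0 <= (x ^+ 2 * a + y ^+ 2 * b) ^+ 2 by exact: sqr_ge0.
rewrite mulrDr e1.
have e5 : D * (x * y - u * T / 2) ^+ 2 =
  (x * y) ^+ 2 * D + T * (u ^+ 2 / 4 * D * T) - T * (u * D * (x * y)) by field.
by rewrite e5 in e3; lra.
Qed.

Context (S I : finType) (flip : I -> S -> S).
Context (flipK : forall i, involutive (flip i)).

(** Sum over coordinates i of two-point bounds between s and its i-th flip, at one fixed
    observation. *)
Lemma assouad_pointwise (p L : S -> R) (M : S -> I -> R) (th : I -> R) (u D : R) :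
  (forall s, 0 <= p s) -> 0 <= D ->
  (forall s, \sum_i (th i - M s i) ^+ 2 <= L s) ->
  (forall s i, D <= (M (flip i s) i - M s i) ^+ 2) ->
  \sum_i \sum_s u * D / 2 * Num.sqrt (p s * p (flip i s)) <=
  \sum_s p s * L s + \sum_s #|I|%:R * (u ^+ 2 / 4 * D) * p s.
Proof.
move=> p0 D0 hL hD.
have h1 : \sum_s p s * \sum_i (th i - M s i) ^+ 2 <= \sum_s p s * L s.
  by apply: ler_sum => s _; rewrite ler_wpM2l.
apply: le_trans (lerD h1 (lexx _)).
have -> : \sum_s p s * \sum_i (th i - M s i) ^+ 2 =
    \sum_i \sum_s p s * (th i - M s i) ^+ 2.
  by rewrite exchange_big; apply: eq_bigr => s _; rewrite mulr_sumr.
have -> : \sum_s #|I|%:R * (u ^+ 2 / 4 * D) * p s =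
    \sum_(i : I) \sum_s (u ^+ 2 / 4 * D) * p s.
  by rewrite sumr_const -mulr_sumr -mulrA mulr_natl mulr_sumr.
rewrite -big_split /=; apply: ler_sum => i _; rewrite -big_split /=.
(* Averaging over the involution pairs s with its flip; the factor 1/2 is the one in u D / 2. *)
have sym (F : S -> R) : \sum_s F s = \sum_s (F s + F (flip i s)) / 2.
  have e : \sum_s F s = \sum_s F (flip i s) by exact: reindex_inj (inv_inj (flipK i)).
  by rewrite -mulr_suml big_split /= -e mulrDl -splitr.
rewrite [leRHS]sym; apply: ler_sum => s _.
have := @two_point_sq (p s) (p (flip i s)) (th i - M s i) (th i - M (flip i s) i) u D
  (p0 _) (p0 _) D0.
have -> : th i - M (flip i s) i - (th i - M s i) = - (M (flip i s) i - M s i) by ring.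
by rewrite sqrrN => /(_ (hD _ _)); lra.
Qed.

(** Integration of the pointwise inequality at u = rho: the affinities bound its left side from
    below, while B and the unit masses of the densities bound its right side from above. *)
Lemma assouad N (p L : S -> N.-tuple R -> R) (M : S -> I -> R)
    (th : I -> N.-tuple R -> R) (D rho : R) (B : \bar R) (s0 : S) :
  (forall s t, 0 <= p s t) -> 0 <= D -> 0 <= rho ->
  (forall s, measurable_fun [set: N.-tuple R] (p s)) ->
  (forall s, measurable_fun [set: N.-tuple R] (L s)) ->
  (forall s t, \sum_i (th i t - M s i) ^+ 2 <= L s t) ->
  (forall s i, D <= (M (flip i s) i - M s i) ^+ 2) ->
  (forall s, leb_int (fun t => (p s t)%:E) = 1%E) ->
  (forall s i,
    (rho%:E <= leb_int (fun t => (Num.sqrt (p s t * p (flip i s) t))%:E))%E) ->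
  (forall s, (leb_int (fun t => (p s t)%:E * (L s t)%:E) <= B)%E) ->
  ((#|I|%:R * D * rho ^+ 2 / 4)%:E <= B)%E.
Proof.
move=> p0 D0 r0 mp mL hL hD hp hr.
have L0 s t : 0 <= L s t.
  by apply: le_trans (hL s t); apply: sumr_ge0 => i _; exact: sqr_ge0.
have mpE s : measurable_fun [set: N.-tuple R] (fun t => (p s t)%:E).
  exact/measurable_EFinP.
have mpL s : measurable_fun [set: N.-tuple R] (fun t => (p s t * L s t)%:E).
  by apply/measurable_EFinP; exact: measurable_funM.
have ms i s : measurable_fun [set: N.-tuple R]
    (fun t => (Num.sqrt (p s t * p (flip i s) t))%:E).
  apply/measurable_EFinP; apply: (@measurableT_comp _ _ _ _ _ _ (@Num.sqrt R)).
    by apply: continuous_measurable_fun; exact: sqrt_continuous.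
  exact: measurable_funM.
(* B = +oo is immediate, and B = -oo contradicts nonnegativity of the risk at [s0]. *)
case: B => [b|_|hB]; last 2 first.
- by rewrite leey.
- by have := hB s0; rewrite leNgt (lt_le_trans (ltNy0) _)//; apply: leb_int_ge0 => t;
    rewrite -EFinM lee_fin mulr_ge0.
move=> hB; pose K := #|I|%:R * (rho ^+ 2 / 4 * D).
have K0 : 0 <= K by rewrite !mulr_ge0 ?divr_ge0 ?sqr_ge0.
have c0 : 0 <= rho * D / 2 by rewrite divr_ge0// mulr_ge0.
have mc i s : measurable_fun [set: N.-tuple R]
    (fun t => (rho * D / 2)%:E * (Num.sqrt (p s t * p (flip i s) t))%:E)%E.
  exact: measurable_funeM.
have mK s : measurable_fun [set: N.-tuple R] (fun t => K%:E * (p s t)%:E)%E.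
  exact: measurable_funeM.
have H : (leb_int (fun t => \sum_i \sum_s
      (rho * D / 2)%:E * (Num.sqrt (p s t * p (flip i s) t))%:E) <=
    leb_int (fun t => \sum_s (p s t * L s t)%:E + \sum_s K%:E * (p s t)%:E))%E.
  apply: le_leb_int.
  - by apply: emeasurable_sum => i; exact: emeasurable_sum.
  - move=> t; apply: sume_ge0 => i _; apply: sume_ge0 => s _.
    by rewrite -EFinM lee_fin mulr_ge0 ?sqrtr_ge0.
  - by apply: emeasurable_funD; exact: emeasurable_sum.
  - move=> t.
    have := @assouad_pointwise (p ^~ t) (L ^~ t) M (th ^~ t) rho D
      (p0 ^~ t) D0 (hL ^~ t) hD.
    rewrite -lee_fin EFinD -!sumEFin; congr (_ <= _)%E.
    by apply: eq_bigr => i _; rewrite -sumEFin.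
have S0 : 0 < #|S|%:R :> R by rewrite ltr0n; apply/card_gt0P; exists s0.
have lo : ((#|I|%:R * (#|S|%:R * (rho * D / 2 * rho)))%:E <=
    leb_int (fun t => \sum_i \sum_s
      (rho * D / 2)%:E * (Num.sqrt (p s t * p (flip i s) t))%:E))%E.
  rewrite leb_int_sum; last 2 first.
  - by move=> i; exact: emeasurable_sum.
  - move=> i t; apply: sume_ge0 => s _.
    by rewrite -EFinM lee_fin mulr_ge0 ?sqrtr_ge0.
  have -> : (#|I|%:R * (#|S|%:R * (rho * D / 2 * rho)))%:E =
      (\sum_(i : I) \sum_(s : S) (rho * D / 2 * rho)%:E)%E :> \bar R.
    under eq_bigr do rewrite sumEFin sumr_const.
    by rewrite sumEFin sumr_const !mulr_natl.
  apply: lee_sum => i _; rewrite leb_int_sum//; last first.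
    by move=> s t; rewrite -EFinM lee_fin mulr_ge0 ?sqrtr_ge0.
  apply: lee_sum => s _; rewrite leb_intZ//.
  by rewrite EFinM lee_wpmul2l ?lee_fin.
have hi : (leb_int (fun t => \sum_s (p s t * L s t)%:E + \sum_s K%:E * (p s t)%:E) <=
    (#|S|%:R * b + #|S|%:R * K)%:E)%E.
  rewrite leb_intD; last 4 first.
  - exact: emeasurable_sum.
  - by move=> t; apply: sume_ge0 => s _; rewrite lee_fin mulr_ge0.
  - exact: emeasurable_sum.
  - by move=> t; apply: sume_ge0 => s _; rewrite -EFinM lee_fin mulr_ge0.
  rewrite EFinD; apply: leeD.
    rewrite leb_int_sum//; last by move=> s t; rewrite lee_fin mulr_ge0.
    have -> : (#|S|%:R * b)%:E = (\sum_(s : S) b%:E)%E :> \bar R.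
      by rewrite sumEFin sumr_const mulr_natl.
    by apply: lee_sum => s _; exact: hB.
  rewrite leb_int_sum//; last by move=> s t; rewrite -EFinM lee_fin mulr_ge0.
  have -> : (#|S|%:R * K)%:E = (\sum_(s : S) K%:E)%E :> \bar R.
    by rewrite sumEFin sumr_const mulr_natl.
  apply: lee_sum => s _; rewrite leb_intZ//; last by move=> t; rewrite lee_fin.
  by rewrite hp mule1.
(* Per parameter, the affinities give #|I| D rho^2 / 2 and the penalty K takes back half of it,
   leaving #|I| D rho^2 / 4. *)
have := le_trans lo (le_trans H hi); rewrite !lee_fin -mulrDr.
rewrite mulrCA ler_pM2l// /K; lra.
Qed.
End Assouad.

(** * The hypercube of sign matrices *)

Section SignFamily.
Context {R : realType} (m r : nat) (delta : R).

Definition sign_slope (s : 'M[bool]_(m, r)) : 'M[R]_(m, r) :=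
  \matrix_(i, j) (if s i j then delta else - delta).

Definition flip_sign (x : 'I_m * 'I_r) (s : 'M[bool]_(m, r)) : 'M[bool]_(m, r) :=
  \matrix_(i, j) (((i, j) == x) (+) s i j).

Lemma flip_signK x : involutive (flip_sign x).
Proof. by move=> s; apply/matrixP => i j; rewrite !mxE addKb. Qed.

Lemma sign_slope_sq s i j : sign_slope s i j ^+ 2 = delta ^+ 2.
Proof. by rewrite mxE; case: ifP; rewrite ?sqrrN. Qed.

Lemma sign_slope_flip s i j :
  exists2 d : R, d ^+ 2 = 4 * delta ^+ 2 &
    sign_slope (flip_sign (i, j) s) - sign_slope s = d *: delta_mx i j.
Proof.
exists (if s i j then - delta *+ 2 else delta *+ 2).
  by case: ifP => _; ring.
apply/matrixP => a b; rewrite !mxE xpair_eqE.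
have [->|ai] := eqVneq a i; last first.
  by rewrite /= subrr mulr0.
have [->|bj] := eqVneq b j; last first.
  by rewrite /= subrr mulr0.
by rewrite /= mulr1; case: (s i j) => /=; ring.
Qed.
End SignFamily.

(** * Risk bound over the hypercube *)

Lemma frob2_lower_left (R : realType) m r (A : 'M[R]_(r + m)) :
  \sum_(x : 'I_m * 'I_r) A (rshift r x.1) (lshift m x.2) ^+ 2 <= frob2 A.
Proof.
rewrite -(pair_bigA _ (fun i j => A (rshift r i) (lshift m j) ^+ 2)) /=.
rewrite /frob2 big_split_ord /= -[leLHS]add0r lerD//.
  by apply: sumr_ge0 => i _; apply: sumr_ge0 => j _; exact: sqr_ge0.
apply: ler_sum => i _; rewrite big_split_ord /= lerDl.
by apply: sumr_ge0 => j _; exact: sqr_ge0.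
Qed.

Lemma mid_precisionC (R : realType) k (S1 S2 : 'M[R]_k) :
  mid_precision S1 S2 = mid_precision S2 S1.
Proof. by rewrite /mid_precision addrC. Qed.

(** [graph_overlap] and [spiked_mid_trace] give a = h d^2 / 2 in [affinity_ge]. The second trace
    condition follows by exchanging the parameters, since the overlap tr (P1 P2) is symmetric. *)
Lemma affinity_graph (R : realType) n m r (lam : R) (W1 W2 : 'M[R]_(m, r))
    (V1 V2 : 'M[R]_(r + m, r)) (i : 'I_m) (j : 'I_r) (d : R) :
  0 < lam ->
  orthonormal_frame V1 -> V1 *m V1^T = graph_proj W1 ->
  orthonormal_frame V2 -> V2 *m V2^T = graph_proj W2 ->
  W2 - W1 = d *: delta_mx i j ->
  ((expR (- (n%:R * (hfun lam / 4 * d ^+ 2))))%:E <=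
   leb_int (fun t : (n * (r + m)).-tuple R =>
    (Num.sqrt (data_density (spiked_cov V1 (fun=> lam)) (tup2mx t) *
               data_density (spiked_cov V2 (fun=> lam)) (tup2mx t)))%:E))%E.
Proof.
move=> lam0 o1 e1 o2 e2 e.
have h0 : 0 <= hfun lam by rewrite divr_ge0 ?sqr_ge0// addr_ge0// ltW.
have := @affinity_ge R n _ _ _ (hfun lam / 2 * d ^+ 2)
  (posdef_spiked lam0 V1) (posdef_spiked lam0 V2).
have -> : expR (- (hfun lam / 2 * d ^+ 2) / 2) ^+ n =
    expR (- (n%:R * (hfun lam / 4 * d ^+ 2))).
  by rewrite -expRM_natl; congr expR; field.
have ov := graph_overlap o1 e1 o2 e2 e.
apply.
  by rewrite spiked_mid_trace// ler_wpM2l// divr_ge0.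
rewrite mid_precisionC spiked_mid_trace// mxtrace_mulC.
by rewrite ler_wpM2l// divr_ge0.
Qed.

(** Assouad with the m r entries of the lower-left block as coordinates. The bounds on m d2 and r d2
    give separation d2, and the bound on n h d2 gives affinity at least exp (-1/5). *)
Lemma max_risk_lower (R : realType) (kappa lam d2 : R) n m r
    (Vh : 'M[R]_(n, r + m) -> 'M[R]_(r + m, r)) :
  1 < kappa -> 0 < lam -> 0 <= d2 ->
  m%:R * d2 <= 5^-1 -> r%:R * d2 <= 5^-1 -> n%:R * hfun lam * d2 <= 5^-1 ->
  estimator Vh ->
  (((m * r)%:R * d2 * expR (- 5^-1) ^+ 2 / 4)%:E <= max_risk kappa lam Vh)%E.
Proof.
move=> kap lam0 d20 hm hr hn [oVh mVh].
pose delta := Num.sqrt d2.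
have dd : delta ^+ 2 = d2 by rewrite sqr_sqrtr.
pose W := @sign_slope R m r delta.
have Wsq s i j : W s i j ^+ 2 = d2 by rewrite /W sign_slope_sq.
have /choice[V hV] : forall s, exists V : 'M[R]_(r + m, r),
    orthonormal_frame V /\ V *m V^T = graph_proj (W s).
  by move=> s; have [V oV eV] := graph_frame (W s); exists V.
pose Sg s := spiked_cov (V s) (fun=> lam).
have pS s : posdef (Sg s) by exact: posdef_spiked.
pose P X := Vh X *m (Vh X)^T.
have mVh' : measurable_mx (fun t : (n * (r + m)).-tuple R => Vh (tup2mx t)).
  by move=> a b; exact: mVh.
have := @assouad R 'M[bool]_(m, r) ('I_m * 'I_r)%type (@flip_sign m r)
  (@flip_signK m r) (n * (r + m))
  (fun s t => data_density (Sg s) (tup2mx t))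
  (fun s t => frob2 (P (tup2mx t) - V s *m (V s)^T))
  (fun s x => (W s *m graph_inv (W s)) x.1 x.2)
  (fun x t => P (tup2mx t) (rshift r x.1) (lshift m x.2))
  d2 (expR (- 5^-1)) (max_risk kappa lam Vh) (const_mx true).
rewrite card_prod !card_ord; apply => //.
- by move=> s t; exact/ltW/data_density_gt0.
- by move=> s; exact: measurable_data_density.
- move=> s; apply: measurable_frob2.
  apply: measurable_mxB (measurable_mx_cst _).
  exact: measurable_mxM mVh' (measurable_mx_tr mVh').
- move=> s t; apply: le_trans (frob2_lower_left _).
  apply: ler_sum => -[i j] _ /=; rewrite mxBE.
  by have [_ ->] := hV s; rewrite graph_proj_slope.
- move=> s [i j] /=.
  have [d d4 e] := sign_slope_flip delta s i j.
  by apply: (@graph_slope_sep _ _ _ (W s) _ i j d) => //; rewrite -?dd.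
- by move=> s; exact: leb_int_data_density.
- move=> s [i j].
  have [d d4 e] := sign_slope_flip delta s i j.
  have [fr1 e1] := hV s; have [fr2 e2] := hV (flip_sign (i, j) s).
  apply: le_trans (affinity_graph n lam0 fr1 e1 fr2 e2 e).
  rewrite lee_fin ler_expR lerN2 d4 dd.
  by apply: le_trans hn; rewrite (_ : _ * (_ * _) = n%:R * hfun lam * d2)//; field.
(* Equal spikes lam are admissible because kappa > 1, so each vertex enters the supremum. *)
- move=> s; apply: ereal_sup_ubound; exists (V s), (fun=> lam); split.
    split; first by case: (hV s).
    by split=> // i; rewrite lexx ler_peMl// ltW.
  by [].
Qed.

Theorem theorem8 (R : realType) :
  exists c : R, 0 < c /\
  forall (kappa : R) (k r n : nat) (lambda : R),
    1 < kappa -> (1 <= r <= k)%N -> (0 < n)%N -> 0 < lambda ->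
    ((c * minr (r%:R) (minr ((k - r)%:R)
         ((r * (k - r))%:R / (n%:R * hfun lambda))))%:E
     <= ereal_inf [set @max_risk R n k r kappa lambda Vh
                  | Vh in [set Vh : 'M[R]_(n, k) -> 'M[R]_(k, r) | estimator Vh]])%E.
Proof.
(* 1/5 is the factor in d2, exp (-1/5) the affinity, and 1/4 comes from Assouad; none involves
   kappa. *)
exists (5^-1 * expR (- 5^-1) ^+ 2 / 4); split.
  by rewrite divr_gt0// mulr_gt0 ?exprn_gt0 ?expR_gt0.
move=> kappa k r n lam kap /andP[r0 rk] n0 lam0.
have [m km] : exists m, k = (r + m)%N by exists (k - r)%N; rewrite subnKC.
subst k; rewrite addKn; apply: le_ereal_inf_tmp => _ [Vh eVh <-].
set M := maxr r%:R m%:R : R; set H := n%:R * hfun lam.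
(* Since r >= 1, M is positive even when k = r, that is m = 0. *)
have M0 : 0 < M by rewrite lt_max ltr0n r0.
have H0 : 0 < H.
  by rewrite mulr_gt0 ?ltr0n// divr_gt0 ?exprn_gt0// addr_gt0.
(* The largest d2 compatible with the three bounds by 1/5. *)
pose d2 := 5^-1 * minr M^-1 H^-1.
have min0 : 0 < minr M^-1 H^-1 by rewrite lt_min !invr_gt0 M0.
have d20 : 0 <= d2 by rewrite mulr_ge0// ltW.
have dM (x : R) : 0 <= x -> x <= M -> x * d2 <= 5^-1.
  move=> x0 xM; rewrite mulrCA ler_piMr//.
  apply: (@le_trans _ _ (M * M^-1)); last by rewrite mulfV// gt_eqF.
  by apply: ler_pM; rewrite ?(ltW min0)// ge_min lexx.
have dH : H * d2 <= 5^-1.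
  rewrite mulrCA ler_piMr//.
  apply: (@le_trans _ _ (H * H^-1)); last by rewrite mulfV// gt_eqF.
  by rewrite ler_pM2l// ge_min lexx orbT.
apply: le_trans (max_risk_lower kap lam0 d20 _ _ dH eVh).
- rewrite lee_fin /d2.
  set E := expR _ ^+ 2; have E0 : 0 <= E by exact: sqr_ge0.
  have -> : (m * r)%:R * (5^-1 * minr M^-1 H^-1) * E / 4 =
     5^-1 * E / 4 * ((m * r)%:R * minr M^-1 H^-1) by ring.
  rewrite ler_wpM2l// ?divr_ge0 ?mulr_ge0//.
  (* If 1 / M is the smaller, m r / M is the minimum of m and r; otherwise m r / H is the third term
     of the rate. *)
  have [_|_] := leP M^-1 H^-1; last by rewrite !ge_min mulnC lexx !orbT.
  rewrite (natrM _ m r); move: M0; rewrite /M.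
  case: (leP (r%:R : R) m%:R) => _ /lt0r_neq0 x0.
    by rewrite mulrAC mulfV// mul1r ge_min lexx.
  by rewrite mulfK// !ge_min lexx orbT.
- by apply: dM => //; rewrite le_max lexx orbT.
- by apply: dM => //; rewrite le_max lexx.
Qed.
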